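(* Every one-relator group with at least two generators, i.e. every group given by a presentation $\langle X \mid r\rangle$ with $|X|\geq 2$ and a single defining relator $r$, has infinite $C$-width.
   Context: For a group $G$ and a generating set $S$ of $G$, the length $l_S(g)$ of $g\in G$ is the minimum number of elements of $S\cup S^{-1}$ needed to express $g$ as a product, and the width of $G$ with respect to $S$ is $\mathrm{wid}(G,S)=\sup_{g\in G} l_S(g)\in\mathbb{N}\cup\{\infty\}$. A generating set $S$ is conjugation invariant if $g^{-1}sg\in S$ for all $s\in S$, $g\in G$. A group $G$ has finite $C$-width if $\mathrm{wid}(G,S)$ is finite for every conjugation invariant generating set $S$ of $G$; otherwise $G$ has infinite $C$-width. *)

(* Defs.v *)
From HB Require Import structures.
From mathcomp Require Import all_boot.
From mathcomp Require Import boolp classical_sets functions cardinality.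

Set Implicit Arguments.
Unset Strict Implicit.
Unset Printing Implicit Defensive.

Local Open Scope classical_set_scope.
Local Open Scope quotient_scope.
Local Open Scope group_scope.

(* The letter (x, false) stands for x and (x, true) for x^-1. *)
Definition word (X : Type) : Type := seq (X * bool).

HB.instance Definition _ (X : Type) := gen_eqMixin (word X).
HB.instance Definition _ (X : Type) := gen_choiceMixin (word X).

Definition inv_letter {X : Type} (a : X * bool) : X * bool := (a.1, ~~ a.2).

Definition inv_word {X : Type} (w : word X) : word X := rev (map inv_letter w).

Inductive free_eq {X : Type} : word X -> word X -> Prop :=
| free_eq_refl u : free_eq u u
| free_eq_sym u v : free_eq u v -> free_eq v u
| free_eq_trans u v w : free_eq u v -> free_eq v w -> free_eq u w
| free_eq_cancel u a v : free_eq (u ++ [:: a, inv_letter a & v]) (u ++ v).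

Section FreeGroup.
Variable X : Type.
Implicit Types u v w : word X.

Definition free_eqb : rel (word X) := fun u v => `[< free_eq u v >].

Fact free_eqb_refl : reflexive free_eqb.
Proof. by move=> u; apply/asboolP; exact: free_eq_refl. Qed.

Fact free_eqb_sym : symmetric free_eqb.
Proof. by move=> u v; apply/asboolP/asboolP; exact: free_eq_sym. Qed.

Fact free_eqb_trans : transitive free_eqb.
Proof.
by move=> v u w /asboolP uv /asboolP vw; apply/asboolP; exact: free_eq_trans vw.
Qed.

Canonical free_equiv :=
  EquivRel free_eqb free_eqb_refl free_eqb_sym free_eqb_trans.

Definition free_group : Type := {eq_quot free_equiv}.

HB.instance Definition _ := Choice.on free_group.
HB.instance Definition _ := EqQuotient.on free_group.

Definition free_class (w : word X) : free_group := \pi_free_group w.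

Lemma free_classP u v : free_class u = free_class v <-> free_eq u v.
Proof.
by split=> [/eqmodP/asboolP //|uv]; apply/eqmodP; apply/asboolP.
Qed.

Lemma free_eq_cat u u' v v' :
  free_eq u u' -> free_eq v v' -> free_eq (u ++ v) (u' ++ v').
Proof.
have catl w : forall s t, free_eq s t -> free_eq (w ++ s) (w ++ t).
  move=> s t; elim=> [z|s1 t1 _|s1 t1 z _ + _|z a t1].
  - exact: free_eq_refl.
  - exact: free_eq_sym.
  - exact: free_eq_trans.
  - by rewrite !catA; exact: free_eq_cancel.
have catr w : forall s t, free_eq s t -> free_eq (s ++ w) (t ++ w).
  move=> s t; elim=> [z|s1 t1 _|s1 t1 z _ + _|z a t1].
  - exact: free_eq_refl.
  - exact: free_eq_sym.
  - exact: free_eq_trans.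
  - by rewrite -!catA /=; exact: free_eq_cancel.
by move=> uu' vv'; apply: free_eq_trans (catr _ _ _ uu') (catl _ _ _ vv').
Qed.

Lemma inv_letterK : involutive (@inv_letter X).
Proof. by case=> x b; rewrite /inv_letter /= negbK. Qed.

Lemma free_eq_inv u v : free_eq u v -> free_eq (inv_word u) (inv_word v).
Proof.
elim=> [z|s t _|s t z _ + _|s a t].
- exact: free_eq_refl.
- exact: free_eq_sym.
- exact: free_eq_trans.
rewrite /inv_word !map_cat !rev_cat /= !rev_cons -!cats1 -!catA /=.
rewrite inv_letterK; exact: free_eq_cancel.
Qed.

Lemma free_eq_mulVw w : free_eq (inv_word w ++ w) [::].
Proof.
elim: w => [|a w IHw]; first exact: free_eq_refl.
rewrite /inv_word /= rev_cons -cats1 -catA /=.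
apply: free_eq_trans IHw.
rewrite -[X in [:: _, X & _]]inv_letterK.
exact: free_eq_cancel.
Qed.

Lemma free_class_repr (x : free_group) : free_class (repr x) = x.
Proof. exact: reprK. Qed.

Lemma repr_free_class w : free_eq (repr (free_class w)) w.
Proof. by apply/free_classP; rewrite free_class_repr. Qed.

Definition free_mul (x y : free_group) : free_group :=
  free_class (repr x ++ repr y).
Definition free_one : free_group := free_class [::].
Definition free_inv (x : free_group) : free_group :=
  free_class (inv_word (repr x)).

Fact free_mulA : associative free_mul.
Proof.
move=> x y z; apply/free_classP.
have H := repr_free_class.
apply: free_eq_trans (free_eq_cat (free_eq_refl _) (H _)) _.
rewrite catA; apply: free_eq_sym.
exact: free_eq_cat (H _) (free_eq_refl _).
Qed.

Fact free_mul1 : left_id free_one free_mul.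
Proof.
move=> x; rewrite -[RHS]free_class_repr; apply/free_classP.
exact: free_eq_cat (repr_free_class [::]) (free_eq_refl _).
Qed.

Fact free_mulx1 : right_id free_one free_mul.
Proof.
move=> x; rewrite -[RHS]free_class_repr; apply/free_classP.
rewrite -[X in free_eq _ X]cats0.
exact: free_eq_cat (free_eq_refl _) (repr_free_class [::]).
Qed.

Fact free_mulV : left_inverse free_one free_inv free_mul.
Proof.
move=> x; apply/free_classP; apply: free_eq_trans (free_eq_mulVw (repr x)).
exact: free_eq_cat (repr_free_class _) (free_eq_refl _).
Qed.

Fact free_mulxV : right_inverse free_one free_inv free_mul.
Proof.
move=> x; rewrite -[LHS]free_mul1 -{1}(free_mulV (free_inv x)).
by rewrite -free_mulA (free_mulA (free_inv x)) free_mulV free_mul1 free_mulV.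
Qed.

HB.instance Definition _ := isGroup.Build free_group
  free_mulA free_mul1 free_mulx1 free_mulV free_mulxV.

Lemma free_classM u v : free_class (u ++ v) = free_class u * free_class v.
Proof.
by apply/free_classP; apply: free_eq_sym; apply: free_eq_cat;
  exact: repr_free_class.
Qed.

Lemma free_class1 : free_class [::] = 1.
Proof. by []. Qed.

Lemma free_classV w : free_class (inv_word w) = (free_class w)^-1.
Proof.
apply/free_classP; apply: free_eq_sym; apply: free_eq_inv.
exact: repr_free_class.
Qed.

End FreeGroup.

Definition is_subgroup {G : groupType} (H : set G) : Prop :=
  [/\ H 1, forall x y, H x -> H y -> H (x * y) & forall x, H x -> H x^-1].

Definition conj_invariant {G : groupType} (S : set G) : Prop :=
  forall s g, S s -> S (s ^ g).

Definition generating {G : groupType} (S : set G) : Prop :=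
  smallest is_subgroup S = setT.

Definition normal_closure {G : groupType} (R : set G) : set G :=
  smallest [set N | is_subgroup N /\ conj_invariant N] R.

(* G is (isomorphic to) the quotient of the free group on X by the normal
   closure of R. *)
Definition is_presentation (X : Type) (R : set (free_group X))
    (G : groupType) : Prop :=
  exists phi : {multiplicative free_group X -> G},
    range phi = setT /\ phi @^-1` [set 1] = normal_closure R.

(* The infimum of P in the extended naturals, None standing for infinity. *)
Definition inf_nat (P : set nat) : option nat :=
  if pselect (exists n, `[< P n >]) is left exP then Some (ex_minn exP)
  else None.

(* s lists the factors, elements of S or inverses of elements of S, of an
   expression of g; the empty product expresses 1. *)
Definition expresses {G : groupType} (S : set G) (g : G) (s : seq G) : Prop :=
  (forall x, x \in s -> (S `|` [set y^-1 | y in S]) x) /\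
  \prod_(x <- s) x = g.

Definition word_length {G : groupType} (S : set G) (g : G) : option nat :=
  inf_nat [set size s | s in expresses S g].

(* The supremum over g of the lengths, as the least upper bound in the
   extended naturals. *)
Definition width {G : groupType} (S : set G) : option nat :=
  inf_nat [set N | forall g, exists2 n, word_length S g = Some n & (n <= N)%N].

Definition finite_C_width (G : groupType) : Prop :=
  forall S : set G, generating S -> conj_invariant S -> width S <> None.

Definition infinite_C_width (G : groupType) : Prop := ~ finite_C_width G.

(* Main.v *)
Require Import Defs.
From HB Require Import structures.
From mathcomp Require Import all_boot.
From mathcomp Require Import boolp classical_sets functions cardinality.
From mathcomp Require Import ssralg ssrint zify.

Local Open Scope classical_set_scope.
Local Open Scope card_scope.

(** A group [G] with at least two generators and one relator [r] has a nonzero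
    homomorphism to the integers: a homomorphism from the free group is a free
    choice of weights on the generators, and killing [r] imposes one linear
    equation on at least two unknowns, which has a nonzero solution
    ([nonzero_weights_killing]).  As the target is abelian, such a homomorphism
    also kills the normal closure of [r], so it descends to [G]
    ([presentation_hom]).

    A nonzero homomorphism [h] from [G] to the integers forces infinite
    C-width ([infinite_C_width_of_hom]).  Fix [t] with [h t <> 0].  The set of
    all [g] with [|h g| <= |h t|] is conjugation invariant, since [h] is
    constant on conjugacy classes, and it generates [G], since an element with
    a larger absolute value is brought into it by multiplying by powers of
    [t].  But a product of [n] of its elements and their inverses has absolute
    value at most [n |h t|], so the powers of [t] have unbounded length. *)

Lemma inf_natP (P : set nat) n : inf_nat P = Some n -> P n.
Proof.
rewrite /inf_nat; case: pselect => // exP [<-].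
by case: ex_minnP => m /asboolP.
Qed.

Section IntHom.
Variables (G : groupType) (h : G -> int).
Hypothesis hM : forall x y, h (x * y)%g = (h x + h y)%R.

Lemma int_hom1 : h 1%g = 0%R.
Proof. by have := hM 1%g 1%g; rewrite mulg1; lia. Qed.

Lemma int_homV x : h x^-1%g = (- h x)%R.
Proof. by have := hM x^-1%g x; rewrite mulVg int_hom1; lia. Qed.

Lemma int_homJ x y : h (x ^ y)%g = h x.
Proof. by rewrite /conjg !hM int_homV; lia. Qed.

Lemma int_homX x n : h (x ^+ n)%g = (h x *+ n)%R.
Proof.
elim: n => [|n IHn]; first by rewrite expg0 int_hom1.
by rewrite expgS hM IHn GRing.mulrS.
Qed.

(** The kernel of [h] is itself a normal subgroup. *)
Lemma int_hom_normal_closure (R : set G) :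
  (forall r, R r -> h r = 0%R) -> forall u, normal_closure R u -> h u = 0%R.
Proof.
move=> hR; apply: (@smallest_sub _ _ _ [set u | h u = 0%R]) => //.
split; last by move=> s g /= hs; rewrite int_homJ.
split=> /= [|x y hx hy|x hx]; first exact: int_hom1.
- by rewrite hM hx hy.
- by rewrite int_homV hx.
Qed.

Definition int_ball (d : nat) : set G := [set g | (`|h g| <= d)%N].

Lemma int_ball_conj_invariant d : conj_invariant (int_ball d).
Proof. by move=> s g; rewrite /int_ball /= int_homJ. Qed.

Lemma int_ball_generating t : h t <> 0%R -> generating (int_ball `|h t|).
Proof.
move=> ht; apply/seteqP; split=> // g _ H [[H1 HM HV] sBH].
have Ht : H t by apply: sBH; rewrite /int_ball /=.
have [n] := ubnP `|h g|%N; elim: n g => // n IHn g lt_g_n.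
have [le_g|lt_g] := leqP `|h g|%N `|h t|%N; first exact: sBH.
(* One of g t and g t^-1 has a smaller absolute value than g: the one whose
   factor t or t^-1 has a value of sign opposite to that of g. *)
have [lt_gt|ge_gt] := ltnP `|h (g * t)%g|%N `|h g|%N.
- rewrite -(mulgK t g); apply: HM (HV _ Ht).
  by apply: IHn; lia.
- rewrite -(mulgVK t g); apply: HM Ht.
  by apply: IHn; move: ge_gt; rewrite !hM int_homV; lia.
Qed.

Lemma int_ball_prod d (s : seq G) :
    (forall x, x \in s -> (int_ball d `|` [set y^-1%g | y in int_ball d]) x) ->
  (`|h (\prod_(x <- s) x)%g| <= size s * d)%N.
Proof.
elim: s => [|x s IHs] sB; first by rewrite big_nil int_hom1.
have /IHs le_s : forall y, y \in s ->
    (int_ball d `|` [set y^-1%g | y in int_ball d]) y.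
  by move=> y ys; apply: sB; rewrite inE ys orbT.
have le_x : (`|h x| <= d)%N.
  case: (sB x (mem_head x s)) => [//|[y By <-]].
  by rewrite int_homV; move: By; rewrite /int_ball /=; lia.
have absD (a b : int) : (`|(a + b)%R| <= `|a| + `|b|)%N by lia.
by rewrite big_cons hM; apply: leq_trans (absD _ _) (leq_add le_x le_s).
Qed.

Lemma infinite_C_width_of_hom t : h t <> 0%R -> infinite_C_width G.
Proof.
move=> ht finG.
have := finG _ (int_ball_generating t ht) (int_ball_conj_invariant _).
case wN : (width _) => [N|] // _; move/inf_natP: wN => wN.
have [n /inf_natP [s [sB prod_s] size_s] le_nN] := wN (t ^+ N.+1)%g.
have := int_ball_prod _ s sB; rewrite prod_s size_s int_homX.
have -> : `|(h t *+ N.+1)%R|%N = (N.+1 * `|h t|)%N.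
  by rewrite -GRing.mulr_natl abszM natz.
by rewrite leq_pmul2r; lia.
Qed.

End IntHom.

Section Weight.
Variable X : Type.
Implicit Types (f : X -> int) (w : word X) (u : free_group X).

Definition letter_weight f (a : X * bool) : int :=
  if a.2 then (- f a.1)%R else f a.1.

Definition word_weight f w : int := (\sum_(a <- w) letter_weight f a)%R.

Lemma word_weight_free_eq f w w' :
  free_eq w w' -> word_weight f w = word_weight f w'.
Proof.
elim=> // [u v w1 _ -> _ -> //|u [x b] v].
rewrite /word_weight !big_cat !big_cons /letter_weight.
by case: b => /=; rewrite ?GRing.addKr ?GRing.addNKr.
Qed.

Definition weight f u : int := word_weight f (repr u).

Lemma weight_class f w : weight f (free_class w) = word_weight f w.
Proof. exact/word_weight_free_eq/repr_free_class. Qed.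

Lemma weightM f u v : weight f (u * v)%g = (weight f u + weight f v)%R.
Proof.
by rewrite -[in LHS](free_class_repr u) -[in LHS](free_class_repr v)
           -free_classM weight_class /word_weight big_cat.
Qed.

Lemma weight_gen f x : weight f (free_class [:: (x, false)]) = f x.
Proof. by rewrite weight_class /word_weight big_seq1. Qed.

Lemma weight_lincomb f g (a b : int) u :
  weight (fun z => f z * a + g z * b)%R u
    = (weight f u * a + weight g u * b)%R.
Proof.
rewrite /weight /word_weight !GRing.mulr_suml -big_split /=.
by apply: eq_bigr => -[x []] _; rewrite /letter_weight /=; lia.
Qed.

(** With [ex] and [ey] the exponent sums of [x] and [y] in [r], the weights
    [ey] for [x], [- ex] for [y] and [0] for the other generators kill [r].
    They vanish only for [ex = ey = 0]; when [ex = 0], the weight [1] for [x]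
    and [0] for the other generators kills [r]. *)
Lemma nonzero_weights_killing (x y : X) (r : free_group X) :
  x <> y -> exists f, weight f r = 0%R /\ exists z, f z <> 0%R.
Proof.
move=> neq_xy; pose delta (p z : X) : int := (`[< z = p >] : nat).
have [ex0|ex_neq0] := eqVneq (weight (delta x) r) 0%R.
  by exists (delta x); split=> //; exists x; rewrite /delta asboolT.
pose ex := weight (delta x) r; pose ey := weight (delta y) r.
exists (fun z => delta x z * ey + delta y z * - ex)%R; split.
  by rewrite weight_lincomb -/ex -/ey; lia.
exists y; rewrite /delta asboolF; last exact: nesym.
by rewrite asboolT // /ex; move/eqP: ex_neq0; lia.
Qed.

End Weight.

(** A homomorphism from the free group that kills the relators factors through
    the presented group because two preimages of an element differ by an
    element of the normal closure, where the homomorphism vanishes. *)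
Lemma presentation_hom (X : Type) (R : set (free_group X)) (G : groupType)
    (h : free_group X -> int) :
    is_presentation R G ->
    (forall u v, h (u * v)%g = (h u + h v)%R) ->
    (forall r, R r -> h r = 0%R) ->
  exists h' : G -> int,
    (forall x y, h' (x * y)%g = (h' x + h' y)%R) /\
    forall u, exists g, h' g = h u.
Proof.
move=> [phi [phi_surj phi_ker]] hM hR.
have h_phi u v : phi u = phi v -> h u = h v.
  move=> phi_uv; have : normal_closure R (u * v^-1)%g.
    by rewrite -phi_ker; apply: (mulIg (phi v)); rewrite -gmulfM mulgVK mul1g.
  move/(int_hom_normal_closure _ h hM R hR).
  by rewrite hM (int_homV _ h hM); lia.
have pre g : exists u, phi u = g.
  have : range phi g by rewrite phi_surj.
  by case=> u _ <-; exists u.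
pose s g := projT1 (cid (pre g)).
have sK g : phi (s g) = g by rewrite /s; case: cid.
exists (h \o s); split=> [x y|u] /=.
  by rewrite -hM; apply: h_phi; rewrite gmulfM !sK.
by exists (phi u); apply: h_phi; rewrite sK.
Qed.

Lemma two_distinct_of_card (X : Type) :
  `I_2 #<= [set: X] -> exists x y : X, x <> y.
Proof.
move=> /card_leP[f].
pose i (k : nat) (lt_k2 : (k < 2)%N) := f (SigSub (mem_set lt_k2 : k \in `I_2)).
exists (val (i 0 isT)), (val (i 1 isT)) => /val_inj /inj.
by rewrite !inE => /(_ I I).
Qed.

Theorem corollary7 (X : Type) (r : free_group X) (G : groupType)
    (hX : `I_2 #<= [set: X]) (hG : is_presentation [set r] G) :
  infinite_C_width G.
Proof.
have [x [y neq_xy]] := two_distinct_of_card _ hX.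
have [f [fr0 [z fz]]] := nonzero_weights_killing _ x y r neq_xy.
have fR r' : [set r] r' -> weight _ f r' = 0%R by move=> ->.
have [h [hM h_lift]] := presentation_hom _ _ _ _ hG (weightM _ f) fR.
have [g hg] := h_lift (free_class [:: (z, false)]).
by apply: (infinite_C_width_of_hom _ h hM g); rewrite hg weight_gen.
Qed.
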